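(* Let $\mathbb{G}$ be a stratified group whose first stratum has dimension $N\ge2$. Let $\Omega\subset\mathbb{G}$ be a bounded domain with $0\in\Omega$, and let $R=\sup_{x\in\Omega}|x'|$. Then for all $f\in C_0^\infty(\Omega\setminus\{x'=0\})$, $$\|f\|_{L^N(\Omega)}\le\left\||x'|\,\frac{x'}{|x'|}\cdot\nabla_Hf\right\|_{L^N(\Omega)}$$ and consequently $$\|f\|_{L^N(\Omega)}\le R\,\|\nabla_Hf\|_{L^N(\Omega)}.$$
   Context: A stratified group (homogeneous Carnot group) is a Lie group $\mathbb{G}=(\mathbb{R}^n,\circ)$ such that: (a) for some natural numbers $N=N_1,N_2,\dots,N_r$ with $N_1+\dots+N_r=n$, writing $\mathbb{R}^n=\mathbb{R}^{N}\times\mathbb{R}^{N_2}\times\dots\times\mathbb{R}^{N_r}$, for every $\lambda>0$ the dilation $\delta_\lambda(x',x^{(2)},\dots,x^{(r)})=(\lambda x',\lambda^2x^{(2)},\dots,\lambda^r x^{(r)})$ is an automorphism of $\mathbb{G}$, where $x'\in\mathbb{R}^N$ and $x^{(k)}\in\mathbb{R}^{N_k}$; (b) if $X_1,\dots,X_N$ are the left-invariant vector fields on $\mathbb{G}$ with $X_k(0)=\partial/\partial x'_k|_0$, then the iterated commutators of $X_1,\dots,X_N$ span the Lie algebra of $\mathbb{G}$ (rank $n$ at every point). $N$ is the dimension of the first stratum. Points are written $x=(x',x'')$ with $x'\in\mathbb{R}^N$ the first-stratum variables, and $|x'|$ is the Euclidean norm on $\mathbb{R}^N$. $\nabla_H=(X_1,\dots,X_N)$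 is the horizontal gradient, $x'\cdot\nabla_Hf=\sum_{k=1}^N x'_kX_kf$ and $|\nabla_H f|=(\sum_k|X_kf|^2)^{1/2}$. $L^N(\Omega)$ is with respect to Lebesgue measure $dx$ on $\mathbb{R}^n$; the norm of a vector-valued function is that of its Euclidean length. $C_0^\infty(U)$ denotes smooth complex-valued functions with compact support in the open set $U$. *)

(* Defs.v *)
From HB Require Import structures.
From mathcomp Require Import all_boot all_order all_algebra.
From mathcomp Require Import all_classical all_reals all_analysis.
From mathcomp Require Import complex.

Set Implicit Arguments.
Unset Strict Implicit.
Unset Printing Implicit Defensive.

Import Order.TTheory GRing.Theory Num.Theory.
Import numFieldNormedType.Exports.

Local Open Scope classical_set_scope.
Local Open Scope ring_scope.

(* The product sigma-algebra, which over the reals is the Borel one. *)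
Section measurable_rV.
Context {d : measure_display} {T : measurableType d}.
Variable n : nat.

Let coord (i : 'I_n) (x : 'rV[T]_n) : T := x ord0 i.

Let rV_set0 : g_sigma_preimage coord set0.
Proof. exact: sigma_algebra0. Qed.

Let rV_setC A : g_sigma_preimage coord A -> g_sigma_preimage coord (~` A).
Proof. exact: sigma_algebraC. Qed.

Let rV_bigcup (F : (set 'rV[T]_n)^nat) :
  (forall i, g_sigma_preimage coord (F i)) ->
  g_sigma_preimage coord (\bigcup_i (F i)).
Proof. exact: sigma_algebra_bigcup. Qed.

HB.instance Definition _ := @isMeasurable.Build (measure_tuple_display d)
  'rV[T]_n (g_sigma_preimage coord) rV_set0 rV_setC rV_bigcup.
End measurable_rV.


Lemma measurable_rV_coord d (T : measurableType d) n (i : 'I_n) :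
  measurable_fun [set: 'rV[T]_n] (fun x : 'rV[T]_n => x ord0 i).
Proof.
move=> _ Y mY; rewrite setTI; apply: sub_sigma_algebra => /=.
rewrite -bigcup_seq/=; exists i => /=; first by rewrite mem_index_enum.
by exists Y => //; rewrite setTI.
Qed.

Lemma measurable_fun_rVP d1 d2 (T1 : measurableType d1) (T2 : measurableType d2)
    n (f : T1 -> 'rV[T2]_n) :
  (forall i, measurable_fun [set: T1] (fun t => f t ord0 i)) ->
  measurable_fun [set: T1] f.
Proof.
move=> mf _ A; pose c (i : 'I_n) (x : 'rV[T2]_n) : T2 := x ord0 i.
suff H : g_sigma_preimage (fun i => c i \o f) `<=` measurable.
  by move=> mA; apply: H; rewrite g_sigma_preimage_comp; exists A.
apply: smallest_sub; first exact: sigma_algebra_measurable.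
rewrite -bigcup_seq; apply: bigcup_sub => i _ B [C mC <-]; exact: mf.
Qed.

Section lebesgue_rV.
Context {R : realType}.
Local Notation T := (measurableTypeR R).

Definition rV_cons n (p : T * 'rV[T]_n) : 'rV[T]_n.+1 :=
  \row_(i < n.+1) if unlift ord0 i is Some j then p.2 ord0 j else p.1.

Lemma rV_cons0 n (p : T * 'rV[T]_n) : rV_cons p ord0 ord0 = p.1.
Proof. by rewrite mxE unlift_none. Qed.

Lemma rV_consS n (p : T * 'rV[T]_n) j :
  rV_cons p ord0 (lift ord0 j) = p.2 ord0 j.
Proof. by rewrite mxE liftK. Qed.

Lemma measurable_rV_cons n :
  measurable_fun [set: T * 'rV[T]_n] (@rV_cons n).
Proof.
apply: measurable_fun_rVP => i; have [j ->|->] := unliftP ord0 i.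
  under eq_fun do rewrite rV_consS.
  exact: (measurableT_comp (measurable_rV_coord j) measurable_snd).
by under eq_fun do rewrite rV_cons0; exact: measurable_fst.
Qed.

Section lebesgue_cons.
Variables (n : nat) (mu : {sigma_finite_measure set 'rV[T]_n -> \bar R}).
Local Open Scope ereal_scope.

Definition lebesgue_cons : set 'rV[T]_n.+1 -> \bar R :=
  pushforward (@lebesgue_measure R \x mu) (@rV_cons n).

Let m0 : lebesgue_cons set0 = 0.
Proof. by rewrite /lebesgue_cons /pushforward preimage_set0 measure0. Qed.

Let m_ge0 A : 0 <= lebesgue_cons A.
Proof. by rewrite /lebesgue_cons /pushforward measure_ge0. Qed.

Let m_sigma_additive : semi_sigma_additive lebesgue_cons.
Proof.
have mf := @measurable_rV_cons n.
move=> F mF tF mUF; rewrite /lebesgue_cons /pushforward preimage_bigcup.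
apply: measure_semi_sigma_additive.
- by move=> k; rewrite -[X in measurable X]setTI; exact: mf.
- apply/trivIsetP => /= i j _ _ ij; rewrite -preimage_setI.
  by move/trivIsetP : tF => /(_ _ _ _ _ ij) ->//; rewrite preimage_set0.
- by rewrite -preimage_bigcup -[X in measurable X]setTI; exact: mf.
Qed.

HB.instance Definition _ := isMeasure.Build _ _ _
  lebesgue_cons m0 m_ge0 m_sigma_additive.

Let m_sigma_finite : sigma_finite setT lebesgue_cons.
Proof.
have : sigma_finite setT (@lebesgue_measure R \x mu).
  have /sigma_finiteP[F [TF ndF Foo]] := sigma_finiteT (@lebesgue_measure R).
  have /sigma_finiteP[G [TG ndG Goo]] := sigma_finiteT mu.
  exists (fun k => F k `*` G k).
    rewrite -setXTT TF TG predeqE => -[x y]; split.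
      move=> [/= [k _ Fkx] [l _ Gly]]; exists (maxn k l) => //; split.
      - by move: x Fkx; exact/subsetPset/ndF/leq_maxl.
      - by move: y Gly; exact/subsetPset/ndG/leq_maxr.
    by move=> [k _ []/= ? ?]; split; exists k.
  move=> k; have [? ?] := Foo k; have [? ?] := Goo k.
  split; first exact: measurableX.
  by rewrite product_measure1E// lte_mul_pinfty// ge0_fin_numE.
move=> [F TF Foo].
pose uncons (x : 'rV[T]_n.+1) : (T * 'rV[T]_n)%type :=
  (x ord0 ord0, \row_j x ord0 (lift ord0 j)).
have consK : cancel (@rV_cons n) uncons.
  move=> [t x]; rewrite /uncons rV_cons0; congr pair.
  by apply/rowP => j; rewrite mxE rV_consS.
have munc : measurable_fun [set: 'rV[T]_n.+1] uncons.
  apply: measurable_fun_pair; first exact: measurable_rV_coord.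
  apply: measurable_fun_rVP => i; under eq_fun do rewrite mxE.
  exact: measurable_rV_coord.
exists (fun k => uncons @^-1` (F k)).
  by rewrite -preimage_bigcup -TF preimage_setT.
move=> k; have [mFk Fkoo] := Foo k; split.
  by rewrite -[X in measurable X]setTI; exact: munc.
rewrite /lebesgue_cons /pushforward -comp_preimage.
by rewrite (_ : uncons \o _ = id)//; apply/funext => p /=; rewrite consK.
Qed.

HB.instance Definition _ := Measure_isSigmaFinite.Build _ _ _
  lebesgue_cons m_sigma_finite.

End lebesgue_cons.

Fixpoint lebesgue_rV n : {sigma_finite_measure set 'rV[T]_n -> \bar R} :=
  match n with
  | 0 => @dirac _ 'rV[T]_0 (0 : 'rV[R]_0) R
  | n'.+1 => lebesgue_cons (lebesgue_rV n')
  end.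

Lemma lebesgue_rV_box n (A : 'I_n -> set T) : (forall i, measurable (A i)) ->
  lebesgue_rV n [set x | forall i, A i (x ord0 i)] =
  (\prod_(i < n) lebesgue_measure (A i))%E.
Proof.
elim: n A => [|n IH] A mA /=.
  rewrite big_ord0 /= diracE mem_set//= => -[].
  by [].
have mB : measurable [set x : 'rV[T]_n | forall i, A (lift ord0 i) (x ord0 i)].
  have -> : [set x : 'rV[T]_n | forall i, A (lift ord0 i) (x ord0 i)] =
      \bigcap_(i in [set: 'I_n])
        ((fun x : 'rV[T]_n => x ord0 i) @^-1` A (lift ord0 i)).
    by apply/seteqP; split=> x /= h i => [_|]; exact: h.
  apply: fin_bigcap_measurable => //= i _.
  by rewrite -[X in measurable X]setTI; exact: measurable_rV_coord.
rewrite /lebesgue_cons /pushforward big_ord_recl.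
rewrite -(IH (fun i => A (lift ord0 i)))// -product_measure1E//.
congr (_ _); apply/seteqP; split => -[t x] /=.
  move=> h; split=> [|i]; first by have := h ord0; rewrite rV_cons0.
  by have := h (lift ord0 i); rewrite rV_consS.
move=> [h0 h] i; have [j ->|->] := unliftP ord0 i; last by rewrite rV_cons0.
by rewrite rV_consS; exact: h.
Qed.

End lebesgue_rV.

Section smooth.
Context {R : realType} {V W : normedModType R}.

(* For finite-dimensional V this is the usual class C^k: continuity of
   x |-> 'd f x (or of its derivatives) as a linear map amounts to continuity
   of x |-> 'd f x v for every v. *)
Fixpoint C_k (k : nat) (f : V -> W) : Prop :=
  if k is k'.+1 then
    (forall x, differentiable f x) /\ (forall v, C_k k' (fun x => 'd f x v))
  else continuous f.

Definition smooth (f : V -> W) : Prop := forall k, C_k k f.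

End smooth.

Section vector_fields.
Context {R : realType} {n : nat}.
Local Notation G := 'rV[R]_n.

Definition lie_group (op : G -> G -> G) : Prop :=
  exists (e : G) (inv : G -> G),
    [/\ associative op, left_id e op, left_inverse e inv op,
        smooth (fun p : G * G => op p.1 p.2) & smooth inv].

(* The vector field \sum_i a_i(x) \partial_i is represented by its coefficient
   function a : G -> G. *)
Definition left_invariant (op : G -> G -> G) (Y : G -> G) : Prop :=
  forall a x, Y (op a x) = 'd (op a) x (Y x).

Definition lie_bracket (Y Z : G -> G) : G -> G :=
  fun x => 'D_(Y x) Z x - 'D_(Z x) Y x.

Inductive iterated_commutator (I : Type) (X : I -> G -> G) : (G -> G) -> Prop :=
| iterated_commutator_gen i : iterated_commutator X (X i)
| iterated_commutator_bracket Y Z :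
    iterated_commutator X Y -> iterated_commutator X Z ->
    iterated_commutator X (lie_bracket Y Z).

Definition bracket_generating (I : Type) (X : I -> G -> G) : Prop :=
  forall x, exists Y : 'I_n -> G -> G,
    (forall i, iterated_commutator X (Y i)) /\ \rank (\matrix_i Y i x) = n.

Definition vf_apply (Y : G -> G) (f : G -> R[i]) (x : G) : R[i] :=
  ('D_(Y x) (fun y => complex.Re (f y)) x +i* 'D_(Y x) (fun y => complex.Im (f y)) x)%C.

Definition test_function (U : set G) (f : G -> R[i]) : Prop :=
  [/\ smooth (fun x => complex.Re (f x)), smooth (fun x => complex.Im (f x)),
      compact (closure [set x | f x != 0]) &
      closure [set x | f x != 0] `<=` U].

Definition enorm (v : G) : R := Num.sqrt (\sum_i v ord0 i ^+ 2).

(* \_ D is extension by zero outside D; g is the modulus of the function whose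
   norm is taken. *)
Definition Lp_norm (p : R) (D : set G) (g : G -> R) : \bar R :=
  'N[lebesgue_rV n]_(p%:E)[(EFin \o g) \_ D]%E.

End vector_fields.

(* The strata dimensions N_1, N_2, ..., N_r are the sequence N :: s, and the
   underlying space is R^n with n = N + sumn s = sumn (N :: s). *)
Section stratified.
Context {R : realType} {N : nat} {s : seq nat}.
Local Notation G := 'rV[R]_(N + sumn s).

(* reshape_index (N :: s) i is the 0-based number of the stratum of the
   coordinate i. *)
Definition weight (i : 'I_(N + sumn s)) : nat := (reshape_index (N :: s) i).+1.

Definition dilation (lambda : R) (x : G) : G :=
  \row_i (lambda ^+ weight i * x ord0 i).

Definition horizontal (x : G) : 'rV[R]_N := lsubmx x.

(* Dilations being bijective, they are automorphisms as soon as they are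
   morphisms. *)
Record stratified_group (op : G -> G -> G) (X : 'I_N -> G -> G) : Prop := {
  stratified_lie_group : lie_group op;
  stratified_dilation : forall lambda, 0 < lambda ->
    {morph dilation lambda : x y / op x y};
  stratified_left_invariant : forall k, left_invariant op (X k);
  stratified_frame0 : forall k, X k 0 = delta_mx ord0 (lshift (sumn s) k);
  stratified_bracket_generating : bracket_generating X
}.

Definition hgrad (X : 'I_N -> G -> G) (f : G -> R[i]) (x : G) : 'rV[R[i]]_N :=
  \row_k vf_apply (X k) f x.

Definition hdot (v : 'rV[R]_N) (w : 'rV[R[i]]_N) : R[i] :=
  \sum_k ((v ord0 k)%:C)%C * w ord0 k.

Definition cnorm (w : 'rV[R[i]]_N) : R :=
  Num.sqrt (\sum_k Normc.normc (w ord0 k) ^+ 2).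

End stratified.

(* Main.v *)
Require Import Defs.
From mathcomp Require Import all_boot all_order all_algebra.
From mathcomp Require Import all_classical all_reals all_analysis.
From mathcomp Require Import measurable_realfun complex ring lra.

Set Implicit Arguments.
Unset Strict Implicit.
Unset Printing Implicit Defensive.

Import Order.TTheory GRing.Theory Num.Theory.
Import numFieldNormedType.Exports.

Local Open Scope classical_set_scope.
Local Open Scope ring_scope.

(** The horizontal radial field Z = sum_k x'_k X_k has divergence N, so for
    g = |f|^N the divergence of g Z is N g + Z g, and it integrates to zero
    because f has compact support ([integral_partial_eq0]). Since
    Z g = N |f|^(N-2) Re (conj(f) Z f) >= - N |f|^(N-1) |Z f|, Young's
    inequality N |f|^(N-1) |Z f| <= (N-1) |f|^N + |Z f|^N gives the pointwise
    bound |f|^N <= |Z f|^N + div (g Z) ([divergence_lower_bound]), and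
    integrating it yields the first inequality ([radial_hardy]), with
    Z f = x' . grad_H f. The second inequality follows from the Cauchy-Schwarz
    bound |x' . grad_H f| <= |x'| |grad_H f| ([normc_hdot_le]).

    That Z has divergence N comes from dilations. Left invariance and the
    automorphism property make the j-th coefficient of X_k homogeneous of
    degree w_j - 1, where w_j is the weight of the coordinate j
    ([field_homogeneous]). Its j-th partial derivative is then continuous and
    homogeneous of degree -1, hence zero ([field_diag]), and for w_j = 1 the
    coefficient is continuous and homogeneous of degree 0, hence the constant
    delta_jk ([field_horizontal]). In the divergence of Z only the derivatives
    of the factors x'_k survive, and each of them contributes 1. *)

(** * Measurability and integrability in R^n *)

Lemma measurable_rV_box (R : realType) n (A : 'I_n -> set (measurableTypeR R)) :
  (forall i, measurable (A i)) ->
  measurable [set x : 'rV[measurableTypeR R]_n | forall i, A i (x ord0 i)].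
Proof.
move=> mA.
have -> : [set x : 'rV[measurableTypeR R]_n | forall i, A i (x ord0 i)] =
    \bigcap_(i in [set: 'I_n])
      ((fun x : 'rV[measurableTypeR R]_n => x ord0 i) @^-1` A i).
  by apply/seteqP; split=> x /= h i => [_|]; exact: h.
apply: fin_bigcap_measurable => //= i _.
by rewrite -[X in measurable X]setTI; exact: measurable_rV_coord.
Qed.

(** An open set is the union of the countably many cubes with rational centre
    and radius 1/(k+1) that it contains, and cubes belong to the product
    sigma-algebra. *)
Lemma open_measurable_rV (R : realType) n (U : set 'rV[R]_n) :
  open U -> measurable (U : set 'rV[measurableTypeR R]_n).
Proof.
move=> oU.
pose B (p : 'rV[rat]_n * nat) : set 'rV[R]_n :=
  [set x | forall i, ball (ratr (p.1 ord0 i) : R) (p.2.+1%:R^-1) (x ord0 i)].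
have -> : U = \bigcup_(p in [set p | B p `<=` U]) B p.
  apply/seteqP; split=> [x Ux|x [p /= pU /pU//]].
  have /nbhs_ballP[e /= e0 eU] := open_nbhs_nbhs (conj oU Ux).
  (* A cube of radius 1/(k+1) that contains x lies in the ball of radius 2/(k+1)
     around x. *)
  have [k /= ke] : exists k : nat, 2 * k.+1%:R^-1 < e.
    have e20 : 0 < e / 2 by rewrite divr_gt0.
    exists (Num.truncn (e / 2)^-1).
    rewrite mulrC -ltr_pdivlMr// invf_plt ?posrE//.
    by rewrite truncnS_gt.
  have [q qP] : exists q : 'rV[rat]_n,
      forall i, ball (ratr (q ord0 i) : R) (k.+1%:R^-1) (x ord0 i).
    have : forall i, exists a : rat, ball (ratr a : R) (k.+1%:R^-1) (x ord0 i).
      move=> i; have : x ord0 i - k.+1%:R^-1 < x ord0 i + k.+1%:R^-1.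
        by rewrite ltrD2l gtrN.
      move=> /rat_in_itvoo[a]; rewrite in_itv/= => /andP[a1 a2].
      exists a; rewrite /ball/= ltr_distlC; apply/andP; split.
        by rewrite ltrBlDr.
      by rewrite -ltrBlDr.
    by move=> /choice[q qP]; exists (\row_i q i) => i; rewrite mxE.
  exists (q, k) => //= y yB; apply: eU; split=> // i j; rewrite (ord1 i).
  apply: (le_ball (ltW ke)); rewrite mulr_natl mulr2n.
  apply: ball_triangle (yB j); exact/ball_sym/qP.
rewrite bigcup_mkcond.
apply: (@countable_bigcupT_measurable _ 'rV[measurableTypeR R]_n) => [|p].
  exact: countableP.
case: ifP => // _.
apply: (@measurable_rV_box R n
  (fun i => ball (ratr (p.1 ord0 i) : R) (p.2.+1%:R^-1))) => i.
exact: measurable_ball.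
Qed.

Lemma continuous_measurable_rV (R : realType) n (f : 'rV[R]_n -> R) :
  continuous f ->
  measurable_fun [set: 'rV[measurableTypeR R]_n]
    (f : 'rV[measurableTypeR R]_n -> measurableTypeR R).
Proof.
move=> /continuousP cf; apply: (measurability _ (RGenOpens.measurableE R)).
move=> _ [_ [a [b ->] <-]]; rewrite setTI.
by apply: open_measurable_rV; exact/cf/interval_open.
Qed.

Lemma integrable_rV (R : realType) n (d : 'rV[R]_n -> R) (M C : R) :
  continuous d -> (forall x, `|d x| <= C) ->
  (forall (x : 'rV[R]_n) i, M < `|x ord0 i| -> d x = 0) ->
  (@lebesgue_rV R n).-integrable setT (EFin \o d).
Proof.
move=> cd dC d0.
pose B : set 'rV[R]_n := [set x | forall i, `[-M, M]%classic (x ord0 i)].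
have mB : measurable (B : set 'rV[measurableTypeR R]_n).
  exact: (@measurable_rV_box R n (fun=> `[-M, M]%classic)).
have -> : EFin \o d = (EFin \o d) \_ B.
  apply/funext => x; rewrite patchE; case: ifPn => // /negP xB /=.
  congr EFin; apply: contrapT => dx0; apply: xB; rewrite inE => i.
  rewrite /= in_itv/= -ler_norml leNgt; apply/negP => Mx; apply: dx0.
  exact: d0 Mx.
have Boo : (@lebesgue_rV R n B < +oo)%E.
  rewrite /B (@lebesgue_rV_box R n (fun=> `[-M, M]%classic))//.
  rewrite ltey_eq; apply/orP; left.
  elim/big_ind : _ => //[x y|i _]; first exact: fin_numM.
  by rewrite lebesgue_measure_itv/=; case: ifPn.
rewrite -integrable_mkcond//; apply: measurable_bounded_integrable => //.
- apply: measurable_funTS; exact: continuous_measurable_rV.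
- exists C; split => [|r Cr x _]; first exact: num_real.
  exact: le_trans (ltW Cr).
Qed.

(** * Integrals of partial derivatives *)

Lemma integral_derive_eq0 (R : realType) (F f : R -> R) (M : R) :
  continuous f -> (forall t : R, is_derive t (1 : R) F (f t)) ->
  (forall t : R, M < `|t| -> F t = 0 /\ f t = 0) ->
  (\int[@lebesgue_measure R]_t (f t)%:E = 0)%E.
Proof.
move=> cf dF supp; pose L : R := `|M| + 1.
have ML : M < L by rewrite (le_lt_trans (ler_norm M))// ltrDl.
have L0 : 0 < L by rewrite ltr_pwDr.
have suppL t : L <= `|t| -> F t = 0 /\ f t = 0.
  by move=> Lt; apply: supp; apply: lt_le_trans Lt.
have cF : continuous F.
  move=> t; apply: differentiable_continuous.
  by apply/derivable1_diffP; case: (dF t).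
have -> : (\int[@lebesgue_measure R]_t (f t)%:E =
          \int[@lebesgue_measure R]_(t in `[(- L)%R, L]) (f t)%:E)%E.
  rewrite [RHS]integral_mkcond; apply: eq_integral => t _.
  rewrite patchE; case: ifPn => // /negP tL; congr EFin.
  apply: (suppL t _).2; rewrite leNgt; apply/negP => /ltW.
  rewrite ler_norml => h; by apply: tL; rewrite inE/= in_itv.
rewrite (@continuous_FTC2 _ f F) ?gtrN//.
- by rewrite !(suppL _ _).1 ?subee// ?normrN ger0_norm// ltW.
- exact: continuous_subspaceT.
- split=> [t _||]; first by case: (dF t).
    by apply: cvg_at_right_filter; exact: cF.
  by apply: cvg_at_left_filter; exact: cF.
- by move=> t _; rewrite derive1E; case: (dF t).
Qed.

Section slices.
Context {R : realType} {n : nat}.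

Lemma rV_consDl (t : R) (y : 'rV[R]_n) (h : R) :
  h *: delta_mx ord0 ord0 + rV_cons (t, y) = rV_cons (h + t, y).
Proof.
apply/rowP => i; rewrite !mxE; case: unliftP => [j ->|->] /=.
  by rewrite mulr0 add0r.
by rewrite mulr1.
Qed.

Lemma rV_consDr (t : R) (y : 'rV[R]_n) (j : 'I_n) (h : R) :
  h *: delta_mx ord0 (lift ord0 j) + rV_cons (t, y) =
  rV_cons (t, h *: delta_mx ord0 j + y).
Proof.
apply/rowP => i; rewrite !mxE; case: unliftP => [k ->|->] /=.
  by rewrite !mxE (inj_eq (@lift_inj _ _)).
by rewrite mulr0 add0r.
Qed.

Lemma continuous_rV_consl (y : 'rV[R]_n) :
  continuous (fun t : R => rV_cons (t, y) : 'rV[R]_n.+1).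
Proof.
move=> /= t A /= /(nbhs_ballP (rV_cons (t, y)))[e e0 eA].
apply/nbhs_ballP; exists e => //= s ts; apply: eA; split=> // i j.
by rewrite (ord1 i) !mxE; case: unliftP => [k _|_] //=; exact: ballxx.
Qed.

Lemma continuous_rV_consr (t : R) :
  continuous (fun y : 'rV[R]_n => rV_cons (t, y) : 'rV[R]_n.+1).
Proof.
move=> /= y A /= /(nbhs_ballP (rV_cons (t, y)))[e e0 eA].
apply/nbhs_ballP; exists e => //= z [_ yz]; apply: eA; split=> // i j.
by rewrite (ord1 i) !mxE; case: unliftP => [k _|_] //=; exact: ballxx.
Qed.

End slices.

(** Directional derivatives only see the function along a line, so they are
    transported by any phi that maps the line through x in direction v to the
    line through phi x in direction w.
    This serves slices of a function as well as dilations. *)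
Lemma is_derive_comp_shift (R : realType) (V W : normedModType R)
    (phi : V -> W) (v : V) (w : W) (g : W -> R) x a :
  (forall h : R, h *: w + phi x = phi (h *: v + x)) ->
  is_derive (phi x) w g a -> is_derive x v (g \o phi) a.
Proof.
move=> phiE [dg <-].
have E : (fun h => h^-1 *: ((g \o shift (phi x)) (h *: w) - g (phi x))) =
    (fun h => h^-1 *: (((g \o phi) \o shift x) (h *: v) - (g \o phi) x)).
  by apply/funext => h /=; rewrite phiE.
by apply: DeriveDef; rewrite /derivable /derive -E.
Qed.

(** Fubini's theorem, with an induction on the dimension that follows the
    construction of the measure: for the first coordinate the inner integral
    vanishes by the fundamental theorem of calculus, for any other coordinate
    by the induction hypothesis applied to slices. The bounds M and C are
    uniform so that they pass to slices. *)
Lemma integral_partial_eq0 (R : realType) n (j : 'I_n) (h d : 'rV[R]_n -> R)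
    (M C : R) :
  continuous d -> (forall x, `|d x| <= C) ->
  (forall (x : 'rV[R]_n) i, M < `|x ord0 i| -> h x = 0 /\ d x = 0) ->
  (forall x, is_derive x (delta_mx ord0 j) h (d x)) ->
  (\int[@lebesgue_rV R n]_x (d x)%:E = 0)%E.
Proof.
elim: n j h d => [[]//|n IH] j h d cd dC supp dh.
pose T := measurableTypeR R.
pose phi : T * 'rV[T]_n -> R := d \o @rV_cons R n.
have mphi := @measurable_rV_cons R n.
have md : measurable_fun [set: 'rV[T]_n.+1] (EFin \o d).
  by apply/measurable_EFinP; exact: continuous_measurable_rV.
have intd : ((@lebesgue_measure R) \x (@lebesgue_rV R n))%E.-integrable
    setT (EFin \o phi).
  have /integrableP[_] := integrable_rV cd dC (fun x i Mx => (supp x i Mx).2).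
  rewrite /= ge0_integral_pushforward//=; last first.
    apply/measurable_EFinP; apply: measurableT_comp => //.
    exact: continuous_measurable_rV.
  move=> phioo; apply/integrableP; split => //.
  exact: (measurableT_comp md).
rewrite /= integral_pushforward//=.
have [k jE|jE] := unliftP ord0 j; rewrite {}jE in dh.
- rewrite -integral12_prod_meas1//=.
  rewrite -[RHS](@integral0 _ _ R (@lebesgue_measure R) setT).
  apply: eq_integral => t _.
  apply: (IH k (fun y => h (rV_cons (t, y))) (fun y => phi (t, y))) => //=.
  + move=> y; apply: (@continuous_comp _ _ _ (fun y => rV_cons (t, y)) d).
      exact: continuous_rV_consr.
    exact: cd.
  + by move=> x; apply: dC.
  + move=> x i Mx; apply: (supp _ (lift ord0 i)).
    by rewrite rV_consS.
  + move=> y.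
    apply: (is_derive_comp_shift (w := delta_mx ord0 (lift ord0 k))
      (phi := fun y => rV_cons (t, y))) => //.
    by move=> r; rewrite rV_consDr.
- rewrite -integral21_prod_meas1//=.
  rewrite -[RHS](@integral0 _ _ R (@lebesgue_rV R n) setT).
  apply: eq_integral => y _.
  apply: (@integral_derive_eq0 R (fun t => h (rV_cons (t, y))) _ M).
  + move=> t; apply: (@continuous_comp _ _ _ (fun t => rV_cons (t, y)) d).
      exact: continuous_rV_consl.
    exact: cd.
  + move=> t.
    apply: (is_derive_comp_shift (w := delta_mx ord0 ord0)
      (phi := fun t => rV_cons (t, y))) => //.
    by move=> r; rewrite rV_consDl [r *: _]mulr1.
  + by move=> t Mt; apply: (supp _ ord0); rewrite rV_cons0.
Qed.

(** * Left-invariant fields and dilations *)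

Lemma is_derive_coord (R : realType) (V : normedModType R) n
    (F : V -> 'rV[R]_n) (a v : V) (j : 'I_n) :
  differentiable F a ->
  is_derive a v (fun y => F y ord0 j) ('d F a v ord0 j).
Proof.
move=> dF; have dvF := @diff_derivable _ _ _ F a v dF.
apply: DeriveDef; first exact: (derivable_mxP F a v).1.
by rewrite -deriveE// derive_mx// mxE.
Qed.

Section group_law.
Context {R : realType} {n : nat}.
Local Notation G := 'rV[R]_n.
Context (op : G -> G -> G).
Context (sop : smooth (fun p : G * G => op p.1 p.2)).

Let op2 (p : G * G) : G := op p.1 p.2.

Let dop2 p : differentiable op2 p.
Proof. by have [] := sop 1%N. Qed.

Lemma is_diff_translation a y :
  is_diff y (op a) (fun v => 'd op2 (a, y) (0, v)).
Proof.
have d2 : is_diff (a, y) op2 ('d op2 (a, y)) by exact: differentiableP.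
have dp : is_diff y (fun y : G => (a, y)) (fun v : G => (0, v)).
  exact: is_diff_pair.
exact: (is_diff_comp dp d2).
Qed.

(** A left-invariant field is Y a = d(op)_(a,0) (0, Y 0): its coefficients are
    first derivatives of the group law, so C^2 regularity of the law makes Y a
    field of class C^1. *)
Lemma left_invariant_C1 (Y : G -> G) : left_invariant op Y ->
  (forall a, op a 0 = a) ->
  (forall a, differentiable Y a) /\
  (forall v, continuous (fun a => 'd Y a v)).
Proof.
move=> linv op0.
pose F p := 'd op2 p (0, Y 0).
have [dF cF] : C_k 1 F by have [_ /(_ (0, Y 0))] := sop 2.
have YE : Y = F \o (fun a => (a, 0)).
  apply/funext => a; rewrite -[in LHS](op0 a) linv /F /=.
  by have [_ ->] := is_diff_translation a 0.
have dYE a : is_diff a Y (fun v => 'd F (a, 0) (v, 0)).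
  rewrite YE.
  have d2 : is_diff (a, 0 : G) F ('d F (a, 0)) by exact: differentiableP.
  have dp : is_diff a (fun y : G => (y, 0 : G)) (fun v : G => (v, 0 : G)).
    exact: is_diff_pair.
  exact: (is_diff_comp dp d2).
split=> [a|v]; first by have [] := dYE a.
have -> : (fun a => 'd Y a v) =
    (fun p => 'd F p (v, 0)) \o (fun a => (a, 0 : G)).
  by apply/funext => a; have [_ ->] := dYE a.
move=> a; apply: (@continuous_comp _ _ _ (fun a => (a, 0 : G))
  (fun p => 'd F p (v, 0))); last exact: cF.
by apply: differentiable_continuous; apply: differentiable_pair.
Qed.

End group_law.

Section dilations.
Context {R : realType} {N : nat} {s : seq nat}.
Local Notation G := 'rV[R]_(N + sumn s).
Implicit Types (x y : G) (lambda : R).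

Lemma weight_lshift (k : 'I_N) : @weight N s (lshift (sumn s) k) = 1%N.
Proof. by rewrite /weight /reshape_index /= subn_eq0 ltn_ord. Qed.

Lemma dilationDZ lambda x (i : 'I_(N + sumn s)) (h : R) :
  dilation lambda (h *: delta_mx ord0 i + x) =
  h *: (lambda ^+ weight i *: delta_mx ord0 i) + dilation lambda x.
Proof.
apply/rowP => j; rewrite !mxE mulrDr; congr (_ + _).
have [->|] := eqVneq j i; first by rewrite mulrCA.
by rewrite !mulr0.
Qed.

Lemma dilation_cvg0 x : dilation lambda x @[lambda --> 0^'+] --> (0 : G).
Proof.
move=> A [P P0 PA].
suff : \forall l \near (0 : R)^'+, forall i, P ord0 i (dilation l x ord0 i).
  by apply: filterS => l Pl; apply: PA => i j; rewrite (ord1 i).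
apply: filter_forall => i.
have : l ^+ weight i * x ord0 i @[l --> (0:R)^'+] --> (0 : R).
  apply: cvg_at_right_filter.
  have l0 : 0 ^+ weight i * x ord0 i = 0 by rewrite expr0n mul0r.
  rewrite -[X in _ --> X]l0.
  apply: cvgM; last exact: cvg_cst.
  exact: exprn_continuous.
move=> /(_ (P ord0 i)) h; have P0i := P0 ord0 i; rewrite mxE in P0i.
by near=> l; rewrite mxE; near: l; exact: (h P0i).
Unshelve. all: by end_near. Qed.

(** Homogeneity of degree 0: let lambda tend to 0. *)
Lemma dilation_homogeneous0 (phi : G -> R) x :
  {for 0, continuous phi} ->
  (forall lambda, 0 < lambda -> phi (dilation lambda x) = phi x) ->
  phi x = phi 0.
Proof.
move=> cphi hphi.
have c0 : phi (dilation l x) @[l --> 0^'+] --> phi 0.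
  exact: (cvg_comp _ _ (@dilation_cvg0 x) cphi).
have c1 : phi (dilation l x) @[l --> 0^'+] --> phi x.
  by apply: cvg_near_cst; near=> l; rewrite hphi.
exact: (cvg_unique _ c1 c0).
Unshelve. all: by end_near. Qed.

(** Homogeneity of degree -1: as lambda tends to 0, phi (dilation lambda x)
    stays bounded while the factor lambda kills it. *)
Lemma dilation_homogeneousN1 (phi : G -> R) x :
  {for 0, continuous phi} ->
  (forall lambda, 0 < lambda -> lambda * phi (dilation lambda x) = phi x) ->
  phi x = 0.
Proof.
move=> cphi hphi.
have c0 : l * phi (dilation l x) @[l --> 0^'+] --> 0 * phi 0.
  apply: cvgM; first by apply: cvg_at_right_filter; exact: cvg_id.
  exact: (cvg_comp _ _ (@dilation_cvg0 x) cphi).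
have c1 : l * phi (dilation l x) @[l --> 0^'+] --> phi x.
  by apply: cvg_near_cst; near=> l; rewrite hphi.
by rewrite (cvg_unique _ c1 c0) ?mul0r.
Unshelve. all: by end_near. Qed.

End dilations.

(** * The horizontal frame and the radial field of a stratified group *)

Section stratified_fields.
Context {R : realType} {N : nat} {s : seq nat}.
Local Notation G := 'rV[R]_(N + sumn s).
Context (op : G -> G -> G) (X : 'I_N -> G -> G).
Context (hG : stratified_group op X).

(** The identity is fixed by the dilation of ratio 2, and 0 is the only fixed
    point of that dilation. *)
Lemma stratified_identity :
  (forall a, op 0 a = a) /\ (forall a, op a 0 = a).
Proof.
have [e [inv [opA op1 opV _ _]]] := stratified_lie_group hG.
have opI a : op a a = a -> a = e.
  by move=> aa; rewrite -[LHS]op1 -(opV a) -opA aa.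
have e0 : e = 0.
  have de : dilation (2 : R) e = e.
    by apply: opI; rewrite -(stratified_dilation hG)// op1.
  apply/rowP => i; move/rowP : de => /(_ i); rewrite !mxE => /eqP.
  rewrite -subr_eq0 -{2}[e _ _]mul1r -mulrBl mulf_eq0 => /orP[|/eqP//].
  by rewrite subr_eq0 gt_eqF// exprn_egt1// ltr1n.
rewrite -e0; split=> // a.
have opVr b : op b (inv b) = e.
  by apply: opI; rewrite opA -(opA b) opV -opA op1.
by rewrite -(opV a) opA opVr op1.
Qed.

Lemma field_C1 k : (forall a, differentiable (X k) a) /\
  (forall v, continuous (fun a => 'd (X k) a v)).
Proof.
have [e [inv [_ _ _ sop _]]] := stratified_lie_group hG.
apply: (left_invariant_C1 sop); first exact: (stratified_left_invariant hG).
exact: stratified_identity.2.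
Qed.

Lemma field_continuous k j : continuous (fun x => X k x ord0 j).
Proof.
move=> x; apply: (@continuous_comp _ _ _ (X k) (fun y : G => y ord0 j)).
  exact/differentiable_continuous/(field_C1 k).1.
exact: coord_continuous.
Qed.

Lemma field_translationE a k :
  X k a = 'd (op a) 0 (delta_mx ord0 (lshift (sumn s) k)).
Proof.
rewrite -[in LHS](stratified_identity.2 a) (stratified_left_invariant hG).
by rewrite (stratified_frame0 hG).
Qed.

(** Differentiate delta (x o y) = (delta x) o (delta y) at y = 0 in the
    direction of e_k, which the dilation multiplies by lambda. *)
Lemma field_homogeneous k j lambda x : 0 < lambda ->
  lambda ^+ weight j * X k x ord0 j =
  lambda * X k (dilation lambda x) ord0 j.
Proof.
move=> l0; have [e [inv [_ _ _ sop _]]] := stratified_lie_group hG.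
set ek : G := delta_mx ord0 (lshift (sumn s) k).
have dop a : differentiable (op a) 0.
  by have [] := is_diff_translation sop a 0.
have d0 : dilation lambda (0 : G) = 0.
  by apply/rowP => i; rewrite !mxE mulr0.
have D1 : is_derive (0 : G) ek
    ((fun y => op (dilation lambda x) y ord0 j) \o dilation lambda)
    (lambda * X k (dilation lambda x) ord0 j).
  apply: (is_derive_comp_shift (w := lambda *: ek)) => [h|].
    by rewrite dilationDZ weight_lshift.
  rewrite d0 field_translationE -/ek.
  have -> : lambda * 'd (op (dilation lambda x)) 0 ek ord0 j =
      'd (op (dilation lambda x)) 0 (lambda *: ek) ord0 j.
    by rewrite linearZ mxE.
  exact: is_derive_coord.
have D2 : is_derive (0 : G) ek
    (lambda ^+ weight j *: (fun y => op x y ord0 j))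
    (lambda ^+ weight j *: X k x ord0 j).
  apply: is_deriveZ; rewrite field_translationE.
  exact: is_derive_coord.
have E : (fun y => op (dilation lambda x) y ord0 j) \o dilation lambda =
    lambda ^+ weight j *: (fun y => op x y ord0 j).
  by apply/funext => y /=; rewrite -(stratified_dilation hG)// mxE.
rewrite E in D1.
have [_ E1] := D1; have [_ E2] := D2; exact: etrans (esym E2) E1.
Qed.

Lemma field_horizontal k i x : X k x ord0 (lshift (sumn s) i) = (i == k)%:R.
Proof.
have := @dilation_homogeneous0 R N s
  (fun x => X k x ord0 (lshift (sumn s) i)) x.
rewrite (stratified_frame0 hG) mxE/= (inj_eq (@lshift_inj _ _)).
apply; first exact: field_continuous.
move=> l l0; have := @field_homogeneous k (lshift _ i) l x l0.
by rewrite weight_lshift expr1 => /(mulfI (lt0r_neq0 l0)).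
Qed.

(** Differentiating [field_homogeneous] along e_j brings out one more factor
    lambda ^+ weight j on the right, so the j-th derivative of the j-th
    coefficient has degree -1. *)
Lemma field_diag k j x :
  is_derive x (delta_mx ord0 j) (fun y => X k y ord0 j) 0.
Proof.
have [dX cX] := field_C1 k.
pose ej : G := delta_mx ord0 j.
pose c a := 'd (X k) a ej ord0 j.
have DX a v : is_derive a v (fun y => X k y ord0 j) ('d (X k) a v ord0 j).
  exact: is_derive_coord.
suff c0 : c x = 0 by rewrite -c0; exact: DX.
apply: (@dilation_homogeneousN1 R N s).
  apply: (@continuous_comp _ _ _ (fun a => 'd (X k) a ej)
    (fun y : G => y ord0 j)).
    exact: cX.
  exact: coord_continuous.
move=> l l0.
have lw0 : l ^+ weight j != 0 by rewrite expf_neq0// lt0r_neq0.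
have D1 : is_derive x ej ((fun y => X k y ord0 j) \o dilation l)
    (l ^+ weight j * c (dilation l x)).
  apply: (is_derive_comp_shift (w := l ^+ weight j *: ej)) => [h|].
    by rewrite dilationDZ.
  have -> : l ^+ weight j * c (dilation l x) =
      'd (X k) (dilation l x) (l ^+ weight j *: ej) ord0 j.
    by rewrite linearZ mxE.
  exact: DX.
have D1' : is_derive x ej (l *: ((fun y => X k y ord0 j) \o dilation l))
    (l *: (l ^+ weight j * c (dilation l x))) by exact: is_deriveZ.
have D2 : is_derive x ej (l ^+ weight j *: (fun y => X k y ord0 j))
    (l ^+ weight j *: c x) by exact: is_deriveZ.
have E : l *: ((fun y => X k y ord0 j) \o dilation l) =
    l ^+ weight j *: (fun y => X k y ord0 j).
  by apply/funext => y /=; rewrite [RHS]field_homogeneous.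
rewrite E in D1'.
apply: (mulfI lw0).
have [_ E1] := D1'; have [_ E2] := D2.
by rewrite mulrCA; exact: etrans (esym E1) E2.
Qed.

Definition radial_field (x : G) : G :=
  \sum_k x ord0 (lshift (sumn s) k) *: X k x.

Lemma radial_fieldE x j :
  radial_field x ord0 j = \sum_k x ord0 (lshift (sumn s) k) * X k x ord0 j.
Proof. by rewrite summxE; apply: eq_bigr => k _; rewrite mxE. Qed.

Lemma continuous_radial_field j : continuous (fun x => radial_field x ord0 j).
Proof.
have -> : (fun x => radial_field x ord0 j) =
    (fun x => \sum_k x ord0 (lshift (sumn s) k) * X k x ord0 j).
  by apply/funext => x; rewrite radial_fieldE.
apply: continuous_big => [|k _ x]; first exact: add_continuous.
apply: continuousM; first exact: coord_continuous.
exact: field_continuous.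
Qed.

(** For j in the first stratum the coefficient is x'_j itself; for the other j
    neither x'_k nor the j-th coefficient of X_k varies along e_j. *)
Lemma is_derive_radial_field (x : G) (j : 'I_(N + sumn s)) :
  is_derive x (delta_mx ord0 j) (fun y => radial_field y ord0 j)
    ((j < N)%N%:R : R).
Proof.
have -> : (fun x => radial_field x ord0 j) =
    \sum_k (fun x : G => x ord0 (lshift (sumn s) k) * X k x ord0 j).
  by apply/funext => y; rewrite radial_fieldE fct_sumE.
have -> : ((j < N)%N%:R : R) =
    \sum_(k < N) (x ord0 (lshift (sumn s) k) *: 0 +
       X k x ord0 j *: (delta_mx ord0 j : G) ord0 (lshift (sumn s) k)).
  have [i ->|i ->] := split_ordP j.
    rewrite (bigD1 i)//= big1 => [|k ki].
      by rewrite field_horizontal !mxE !eqxx scaler0 add0r addr0 [_ *: _]mulr1.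
    by rewrite field_horizontal eq_sym (negbTE ki) scaler0 scale0r addr0.
  rewrite big1// => k _.
  by rewrite !mxE/= eq_lrshift scaler0 scaler0 addr0.
apply: is_derive_sum => k.
apply: is_deriveM; last exact: field_diag.
have := @is_derive_coord R _ _ id x (delta_mx ord0 j) (lshift _ k).
by rewrite diff_val; apply.
Qed.

Lemma sum_divergence :
  \sum_(j < N + sumn s) ((j < N)%N%:R : R) = N%:R.
Proof.
rewrite big_split_ord/= [X in _ + X]big1 ?addr0 => [|i _].
  rewrite (eq_bigr (fun=> 1)) ?sumr_const ?card_ord// => i _.
  by rewrite ltn_ord.
by rewrite ltnNge leq_addr.
Qed.

End stratified_fields.

(** * Derivatives of powers of the modulus *)

Lemma is_derive_lineP (R : realType) (V : normedModType R) (g : V -> R)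
    (x e : V) (d : R) :
  is_derive x e g d <-> is_derive (0 : R) (1 : R) (fun h => g (h *: e + x)) d.
Proof.
have E : (fun h => h^-1 *: ((g \o shift x) (h *: e) - g x)) =
    (fun h => h^-1 *: (((fun h : R => g (h *: e + x)) \o shift 0)
      (h *: (1 : R)) - g (0 *: e + x))).
  by apply/funext => h /=; rewrite scale0r add0r addr0 [h *: 1]mulr1.
by split=> -[dg <-]; apply: DeriveDef; rewrite /derivable /derive ?E// -?E.
Qed.

(** Where the modulus vanishes, the square root is not differentiable; there
    |f|^(m+2) = |f|^m |f|^2 is a continuous function times one whose value and
    derivative are zero. *)
Lemma is_derive_modulus_pow1 (R : realType) (u v : R -> R) (du dv : R) (t : R)
    (m : nat) :
  is_derive t (1 : R) u du -> is_derive t (1 : R) v dv ->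
  is_derive t (1 : R) (fun s => Num.sqrt (u s ^+ 2 + v s ^+ 2) ^+ m.+2)
    (m.+2%:R * Num.sqrt (u t ^+ 2 + v t ^+ 2) ^+ m * (u t * du + v t * dv)).
Proof.
move=> Du Dv; pose w s := u s ^+ 2 + v s ^+ 2.
have Dw : is_derive t (1 : R) w (2 * (u t * du + v t * dv)).
  have D : is_derive t (1 : R) (u ^+ 2 + v ^+ 2) _ :=
    is_deriveD (is_deriveX 2 Du) (is_deriveX 2 Dv).
  apply: is_derive_eq D _; rewrite !expr1 mulrDr !mulrA.
  by [].
have [w0|w0] := ltP 0 (w t).
  have D1 : is_derive t (1 : R) (Num.sqrt \o w)
      ((Num.sqrt (w t))^-1 * (u t * du + v t * dv)).
    have Ds := is_derive1_sqrt w0.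
    apply: is_derive_eq; rewrite invfM mulrA; congr (_ * _).
    by rewrite mulrAC mulVf ?mul1r.
  have -> : (fun s => Num.sqrt (u s ^+ 2 + v s ^+ 2) ^+ m.+2) =
      (Num.sqrt \o w) ^+ m.+2.
    by apply/funext => s; rewrite exprfctE.
  have Dm : is_derive t (1 : R) ((Num.sqrt \o w) ^+ m.+2) _ :=
    is_deriveX m.+2 D1.
  apply: is_derive_eq Dm _; rewrite -/(w t) /= exprS.
  have q0 : Num.sqrt (w t) != 0 by rewrite gt_eqF// sqrtr_gt0.
  rewrite [_ *: _]mulrA; congr (_ * _); rewrite -mulrA; congr (_ * _).
  by rewrite mulrAC mulfV// mul1r.
have wt0 : w t = 0 by apply/eqP; rewrite eq_le w0 addr_ge0// sqr_ge0.
have [ut0 vt0] : u t = 0 /\ v t = 0.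
  move/eqP: wt0; rewrite paddr_eq0 ?sqr_ge0// !sqrf_eq0.
  by move=> /andP[/eqP + /eqP].
rewrite ut0 vt0 !mul0r addr0 mulr0.
have -> : (fun s => Num.sqrt (u s ^+ 2 + v s ^+ 2) ^+ m.+2) =
    (fun s => Num.sqrt (w s) ^+ m * w s).
  apply/funext => s; rewrite -[m.+2]addn2 exprD sqr_sqrtr//.
  by rewrite addr_ge0// sqr_ge0.
have [dw dwE] := Dw; rewrite ut0 vt0 !mul0r addr0 mulr0 in dwE.
have cvg0 : h^-1 *: ((fun s => Num.sqrt (w s) ^+ m * w s) (h *: 1 + t) -
    Num.sqrt (w t) ^+ m * w t) @[h --> (0:R)^'] --> (0 : R).
  have -> : (fun h => h^-1 *: ((fun s => Num.sqrt (w s) ^+ m * w s) (h *: 1 + t)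
      - Num.sqrt (w t) ^+ m * w t)) =
    (fun h => Num.sqrt (w (h + t)) ^+ m * (h^-1 *: (w (h *: 1 + t) - w t))).
    apply/funext => h; rewrite wt0 mulr0 !subr0 [h *: 1]mulr1.
    by rewrite [_ *: _]mulrCA.
  rewrite -[X in _ --> X](mulr0 (Num.sqrt (w t) ^+ m)).
  apply: cvgM; last first.
    have : h^-1 *: (w (h *: 1 + t) - w t) @[h --> (0:R)^'] --> 'D_1 w t.
      exact: dw.
    by rewrite dwE.
  have cw : {for t, continuous w}.
    by apply: differentiable_continuous; exact/derivable1_diffP.
  have cF : {for t, continuous (fun s => Num.sqrt (w s) ^+ m)}.
    apply: (@continuous_comp _ _ _ (Num.sqrt \o w) (fun r => r ^+ m)).
      by apply: continuous_comp => //; exact: sqrt_continuous.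
    exact: exprn_continuous.
  apply: cvg_within_filter.
  apply: (@cvg_comp _ _ _ (fun h => h + t) (fun s => Num.sqrt (w s) ^+ m) _
    (nbhs t)); last exact: cF.
  have : h + t @[h --> (0 : R)] --> 0 + t.
    by apply: cvgD; [exact: cvg_id|exact: cvg_cst].
  by rewrite add0r.
apply: DeriveDef; first by apply/cvg_ex; exists 0.
exact: cvg_lim.
Qed.

Lemma is_derive_modulus_pow (R : realType) (V : normedModType R)
    (u v : V -> R) (du dv : R) (x e : V) (m : nat) :
  is_derive x e u du -> is_derive x e v dv ->
  is_derive x e (fun y => Num.sqrt (u y ^+ 2 + v y ^+ 2) ^+ m.+2)
    (m.+2%:R * Num.sqrt (u x ^+ 2 + v x ^+ 2) ^+ m * (u x * du + v x * dv)).
Proof.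
move=> /is_derive_lineP Du /is_derive_lineP Dv; apply/is_derive_lineP.
have := is_derive_modulus_pow1 m Du Dv.
by rewrite scale0r add0r.
Qed.

(** * Functions supported in a compact set *)

Section compact_support.
Context {R : realType} {n : nat}.
Local Notation G := 'rV[R]_n.

(** The bound is put on coordinates because [integral_partial_eq0] needs a
    support condition that slices inherit. *)
Lemma compact_cube (K : set G) : compact K ->
  exists M : R, forall (x : G) i, M < `|x ord0 i| -> ~ K x.
Proof.
move=> /compact_bounded[M [_ MK]]; exists (M + 1) => x i Mx Kx.
have := MK (M + 1); rewrite ltrDl ltr01 => /(_ isT x Kx).
apply/negP; rewrite -ltNge (lt_le_trans Mx)//.
rewrite [leRHS]/Num.norm/= mx_normrE.
by apply/bigmax_geP; right; exists (ord0, i).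
Qed.

Lemma continuous_support_bounded (K : set G) (d : G -> R) : compact K ->
  continuous d -> (forall x, ~ K x -> d x = 0) ->
  exists C, forall x, `|d x| <= C.
Proof.
move=> cK cd d0.
have /compact_bounded[M [_ MK]] : compact (d @` K).
  by apply: continuous_compact => //; exact: continuous_subspaceT.
exists (`|M| + 1) => x; have [Kx|Kx] := pselect (K x).
  apply: (MK (`|M| + 1)); last by exists x.
  by rewrite (le_lt_trans (ler_norm M))// ltrDl.
by rewrite d0// normr0 addr_ge0.
Qed.

Lemma integrable_support (K : set G) (d : G -> R) : compact K ->
  continuous d -> (forall x, ~ K x -> d x = 0) ->
  (@lebesgue_rV R n).-integrable setT (EFin \o d).
Proof.
move=> cK cd d0; have [C dC] := continuous_support_bounded cK cd d0.
have [M MK] := compact_cube cK.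
by apply: (integrable_rV cd dC) => x i /MK /d0; exact.
Qed.

Lemma diff_support (K : set G) (u : G -> R) x e : closed K ->
  (forall y, ~ K y -> u y = 0) -> differentiable u x ->
  ~ K x -> 'd u x e = 0.
Proof.
move=> cK u0 du Kx; rewrite -deriveE//.
rewrite (@near_eq_derive _ _ _ u (cst 0)) ?derive_cst//.
have : nbhs x (~` K) by apply: open_nbhs_nbhs; split=> //; exact: closed_openC.
by apply: filterS => y /u0.
Qed.

Lemma diff_rowE (u : G -> R) x (y : G) :
  'd u x y = \sum_j y ord0 j * 'd u x (delta_mx ord0 j).
Proof.
rewrite [in LHS](row_sum_delta y) linear_sum; apply: eq_bigr => j _.
by rewrite linearZ.
Qed.

Lemma continuous_diff_field (u : G -> R) (F : G -> G) :
  (forall w, continuous (fun x => 'd u x w)) ->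
  (forall j, continuous (fun x => F x ord0 j)) ->
  continuous (fun x => 'd u x (F x)).
Proof.
move=> cu cF.
have -> : (fun x => 'd u x (F x)) =
    (fun x => \sum_j F x ord0 j * 'd u x (delta_mx ord0 j)).
  by apply/funext => x; rewrite diff_rowE.
apply: continuous_big => [|k _ x]; first exact: add_continuous.
apply: (@continuousM _ _ (fun x => F x ord0 k)
  (fun x => 'd u x (delta_mx ord0 k))); [exact: cF|exact: cu].
Qed.

Lemma continuous_modulus (u v : G -> R) m : continuous u -> continuous v ->
  continuous (fun x => Num.sqrt (u x ^+ 2 + v x ^+ 2) ^+ m).
Proof.
move=> cu cv x.
apply: (@continuous_comp _ _ _ (fun x => Num.sqrt (u x ^+ 2 + v x ^+ 2))
  (fun r => r ^+ m)); last exact: exprn_continuous.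
apply: (@continuous_comp _ _ _ (fun x => u x ^+ 2 + v x ^+ 2) Num.sqrt);
  last exact: sqrt_continuous.
apply: continuousD.
  apply: (@continuous_comp _ _ _ u (fun r => r ^+ 2)); first exact: cu.
  exact: exprn_continuous.
apply: (@continuous_comp _ _ _ v (fun r => r ^+ 2)); first exact: cv.
exact: exprn_continuous.
Qed.

End compact_support.

(** * The radial inequality *)

(** Induction on n: multiply the previous case by b and add
    (n+1) a^n (a - b)^2 >= 0. *)
Lemma young_pow (R : realDomainType) (a b : R) n : 0 <= a -> 0 <= b ->
  n.+1%:R * a ^+ n * b <= n%:R * a ^+ n.+1 + b ^+ n.+1.
Proof.
move=> a0 b0; elim: n => [|n IH].
  by rewrite !expr0 !expr1 mulr1 mul1r mul0r add0r.
have H1 := ler_wpM2r b0 IH.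
have H2 : 0 <= n.+1%:R * (a ^+ n * (a - b) ^+ 2).
  by rewrite mulr_ge0 ?ler0n// mulr_ge0 ?sqr_ge0 ?exprn_ge0.
rewrite -subr_ge0; rewrite -subr_ge0 in H1.
apply: le_trans (addr_ge0 H1 H2) _.
rewrite le_eqVlt; apply/orP; left; apply/eqP.
rewrite !exprS -[n.+2]addn2 -[n.+1]addn1 !natrD; ring.
Qed.

Lemma sqrt_cauchy_schwarz (R : rcfType) (a b c d : R) :
  - (Num.sqrt (a ^+ 2 + b ^+ 2) * Num.sqrt (c ^+ 2 + d ^+ 2)) <= a * c + b * d.
Proof.
rewrite -sqrtrM ?addr_ge0 ?sqr_ge0// lerNl.
apply: le_trans (ler_norm _) _; rewrite normrN -sqrtr_sqr.
rewrite ler_wsqrtr// -subr_ge0.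
have -> : (a ^+ 2 + b ^+ 2) * (c ^+ 2 + d ^+ 2) - (a * c + b * d) ^+ 2 =
  (a * d - b * c) ^+ 2 by ring.
exact: sqr_ge0.
Qed.

(** Here r = |f|, t = |Z f| and p = Re (conj(f) Z f); the parenthesis is the
    divergence of |f|^(m+2) Z in dimension m+2 of the first stratum. *)
Lemma divergence_lower_bound (R : realFieldType) (r t p : R) (m : nat) :
  0 <= r -> 0 <= t -> - (r * t) <= p ->
  r ^+ m.+2 <=
  t ^+ m.+2 + (m.+2%:R * r ^+ m.+2 + m.+2%:R * r ^+ m * p).
Proof.
move=> r0 t0 rtp.
have Y := young_pow m.+1 r0 t0.
have P : 0 <= m.+2%:R * r ^+ m by rewrite mulr_ge0 ?exprn_ge0.
have H := ler_wpM2l P rtp.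
have E1 : m.+2%:R * r ^+ m * - (r * t) = - (m.+2%:R * r ^+ m.+1 * t).
  by rewrite exprS; ring.
have E2 : m.+2%:R * r ^+ m.+2 = m.+1%:R * r ^+ m.+2 + r ^+ m.+2.
  by rewrite -[m.+2]addn1 natrD mulrDl mul1r.
rewrite E1 in H; rewrite E2; lra.
Qed.

(** The inequality for f = u + i v in real form: integrate the pointwise bound
    of [divergence_lower_bound]. The exponent N is written m.+2, since
    m = N - 2 occurs in the derivative of |f|^N. *)
Lemma radial_hardy (R : realType) (N : nat) (s : seq nat)
    (op : 'rV[R]_(N + sumn s) -> 'rV[R]_(N + sumn s) -> 'rV[R]_(N + sumn s))
    (X : 'I_N -> 'rV[R]_(N + sumn s) -> 'rV[R]_(N + sumn s))
    (hG : stratified_group op X) (m : nat) (NE : N = m.+2)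
    (u v : 'rV[R]_(N + sumn s) -> R) (K : set 'rV[R]_(N + sumn s)) :
  C_k 1 u -> C_k 1 v -> compact K ->
  (forall x, ~ K x -> u x = 0) -> (forall x, ~ K x -> v x = 0) ->
  (\int[@lebesgue_rV R (N + sumn s)]_x
     (Num.sqrt (u x ^+ 2 + v x ^+ 2) ^+ m.+2)%:E <=
   \int[@lebesgue_rV R (N + sumn s)]_x
     (Num.sqrt ('d u x (radial_field X x) ^+ 2 +
                'd v x (radial_field X x) ^+ 2) ^+ m.+2)%:E)%E.
Proof.
move=> [du cdu] [dv cdv] cK u0 v0.
have clK : closed K by apply: compact_closed => //; exact: norm_hausdorff.
have cu : continuous u by move=> x; exact: differentiable_continuous.
have cv : continuous v by move=> x; exact: differentiable_continuous.
pose Z := radial_field X.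
have cZ j : continuous (fun x => Z x ord0 j).
  exact: (continuous_radial_field hG).
pose r x : R := Num.sqrt (u x ^+ 2 + v x ^+ 2).
pose a x : R := 'd u x (Z x); pose b x : R := 'd v x (Z x).
pose t x : R := Num.sqrt (a x ^+ 2 + b x ^+ 2).
have ca : continuous a := @continuous_diff_field R _ u Z cdu cZ.
have cb : continuous b := @continuous_diff_field R _ v Z cdv cZ.
pose e (j : 'I_(N + sumn s)) : 'rV[R]_(N + sumn s) := delta_mx ord0 j.
(* dr j is the j-th partial derivative of r^N, and d j that of r^N Z_j. *)
pose dr (j : 'I_(N + sumn s)) (x : 'rV[R]_(N + sumn s)) : R :=
  m.+2%:R * r x ^+ m * (u x * 'd u x (e j) + v x * 'd v x (e j)).
pose d (j : 'I_(N + sumn s)) (x : 'rV[R]_(N + sumn s)) : R :=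
  r x ^+ m.+2 * ((j < N)%N%:R : R) + Z x ord0 j * dr j x.
have r0 x : ~ K x -> r x = 0.
  by move=> Kx; rewrite /r u0// v0// !expr0n addr0 sqrtr0.
have a0 x : ~ K x -> a x = 0 by move=> Kx; exact: (diff_support _ clK u0).
have b0 x : ~ K x -> b x = 0 by move=> Kx; exact: (diff_support _ clK v0).
have t0 x : ~ K x -> t x = 0.
  by move=> Kx; rewrite /t a0// b0// !expr0n addr0 sqrtr0.
have d0 j x : ~ K x -> d j x = 0.
  move=> Kx; rewrite /d /dr r0// u0// v0//.
  by rewrite !mul0r addr0 mulr0 mulr0 expr0n mul0r addr0.
have cr k : continuous (fun x => r x ^+ k) :=
  @continuous_modulus R _ u v k cu cv.
have ct k : continuous (fun x => t x ^+ k) :=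
  @continuous_modulus R _ a b k ca cb.
have cdr j : continuous (dr j).
  move=> x; apply: (@continuousM _ _ (fun x => m.+2%:R * r x ^+ m)).
    apply: (@continuousM _ _ (fun=> m.+2%:R) (fun x => r x ^+ m)).
      exact: cst_continuous.
    exact: cr.
  apply: (@continuousD _ _ _ (fun x => u x * _) (fun x => v x * _)).
    by apply: (@continuousM _ _ u); [exact: cu|exact: cdu].
  by apply: (@continuousM _ _ v); [exact: cv|exact: cdv].
have cd j : continuous (d j).
  move=> x; apply: (@continuousD _ _ _ (fun x => r x ^+ m.+2 * _)
    (fun x => Z x ord0 j * dr j x)).
    apply: (@continuousM _ _ (fun x => r x ^+ m.+2)); first exact: cr.
    exact: cst_continuous.
  by apply: (@continuousM _ _ (fun x => Z x ord0 j)); [exact: cZ|exact: cdr].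
have integrd j := integrable_support cK (cd j) (d0 j).
have intd j : (\int[@lebesgue_rV R (N + sumn s)]_x (d j x)%:E = 0)%E.
  have [C dC] := continuous_support_bounded cK (cd j) (d0 j).
  have [M MK] := compact_cube cK.
  apply: (integral_partial_eq0 (j := j) (M := M)
    (h := fun x => r x ^+ m.+2 * Z x ord0 j) (cd j) dC).
    by move=> x i /MK Kx; rewrite d0// r0// expr0n mul0r.
  move=> x; apply: is_deriveM; last exact: (is_derive_radial_field hG).
  apply: is_derive_modulus_pow.
    by apply: DeriveDef; [exact: diff_derivable|exact: deriveE].
  by apply: DeriveDef; [exact: diff_derivable|exact: deriveE].
pose D x : R := \sum_j d j x.
have ED : (fun x => (D x)%:E) = (fun x => \sum_j (d j x)%:E)%E.
  by apply/funext => x; rewrite sumEFin.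
have intD : (\int[@lebesgue_rV R (N + sumn s)]_x (D x)%:E = 0)%E.
  by rewrite ED integral_sum// big1// => j _; exact: intd.
have iD : (@lebesgue_rV R (N + sumn s)).-integrable setT (EFin \o D).
  by rewrite [EFin \o D]ED; apply: integrable_sum => // j _; exact: integrd.
have ir : (@lebesgue_rV R (N + sumn s)).-integrable setT
    (EFin \o (fun x => r x ^+ m.+2)).
  by apply: (integrable_support cK (cr _)) => x Kx; rewrite r0// expr0n.
have it : (@lebesgue_rV R (N + sumn s)).-integrable setT
    (EFin \o (fun x => t x ^+ m.+2)).
  by apply: (integrable_support cK (ct _)) => x Kx; rewrite t0// expr0n.
have DE x : D x = m.+2%:R * r x ^+ m.+2 +
    m.+2%:R * r x ^+ m * (u x * a x + v x * b x).
  rewrite /D /d big_split/= -mulr_sumr sum_divergence [in N%:R]NE mulrC.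
  congr (_ + _); rewrite /a /b !diff_rowE !mulr_sumr -big_split/= mulr_sumr.
  by apply: eq_bigr => j _; rewrite /dr mulrCA mulrDr !(mulrCA (Z x ord0 j)).
have rt x : r x ^+ m.+2 <= t x ^+ m.+2 + D x.
  by rewrite DE; apply: divergence_lower_bound;
    [exact: sqrtr_ge0|exact: sqrtr_ge0|exact: sqrt_cauchy_schwarz].
rewrite -[leRHS]adde0 -intD -integralD//=.
apply: le_integral => //; first exact: (integrableD measurableT it iD).
by move=> x _; rewrite -EFinD lee_fin; exact: rt.
Qed.

(** * The horizontal gradient and L^p norms *)

Lemma normcE (R : rcfType) (z : R[i]) :
  Normc.normc z = Num.sqrt (complex.Re z ^+ 2 + complex.Im z ^+ 2).
Proof. by case: z. Qed.

(** Lagrange's identity. *)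
Lemma sum_cauchy_schwarz (R : realDomainType) n (v a : 'I_n -> R) :
  (\sum_i v i * a i) ^+ 2 <= (\sum_i v i ^+ 2) * (\sum_i a i ^+ 2).
Proof.
have : 0 <= \sum_i \sum_j (v i * a j - v j * a i) ^+ 2.
  by apply: sumr_ge0 => i _; apply: sumr_ge0 => j _; exact: sqr_ge0.
have -> : \sum_i \sum_j (v i * a j - v j * a i) ^+ 2 =
    ((\sum_i v i ^+ 2) * (\sum_i a i ^+ 2) - (\sum_i v i * a i) ^+ 2) *+ 2.
  have -> : \sum_i \sum_j (v i * a j - v j * a i) ^+ 2 =
    \sum_i \sum_j (v i ^+ 2 * a j ^+ 2) + \sum_i \sum_j (a i ^+ 2 * v j ^+ 2)
    - (\sum_i \sum_j ((v i * a i) * (v j * a j))) *+ 2.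
    rewrite -sumrMnl -big_split -sumrB/=; apply: eq_bigr => i _.
    rewrite -sumrMnl -big_split -sumrB/=; apply: eq_bigr => j _.
    by rewrite mulr2n; ring.
  rewrite -!big_distrlr/= (mulrC (\sum_i a i ^+ 2)) -!mulr2n -expr2.
  by rewrite mulrnBl.
by rewrite pmulrn_lge0// subr_ge0.
Qed.

Section hdot.
Context {R : realType} {N : nat}.
Implicit Types (v : 'rV[R]_N) (w : 'rV[R[i]]_N).

Lemma hdotE v w : hdot v w =
  ((\sum_k v ord0 k * complex.Re (w ord0 k)) +i*
   (\sum_k v ord0 k * complex.Im (w ord0 k)))%C.
Proof.
apply/eqP; rewrite eq_complex /hdot !raddf_sum/=.
apply/andP; split; apply/eqP; apply: eq_bigr => k _;
  case: (w ord0 k) => a b /=; first by rewrite mul0r subr0.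
by rewrite mul0r addr0.
Qed.

Lemma hdotZ c v w : hdot (c *: v) w = (c%:C%C * hdot v w)%R.
Proof.
by rewrite /hdot mulr_sumr; apply: eq_bigr => k _; rewrite mxE rmorphM mulrA.
Qed.

Lemma enorm_eq0 v : enorm v = 0 -> v = 0.
Proof.
move/eqP; rewrite sqrtr_eq0 => v0; apply/rowP => i; rewrite mxE; apply/eqP.
rewrite -sqrf_eq0 eq_le sqr_ge0 andbT (le_trans _ v0)//.
by rewrite (bigD1 i)//= lerDl sumr_ge0// => j _; exact: sqr_ge0.
Qed.

(** At v = 0 both sides vanish, the inverse of 0 being 0. *)
Lemma hdot_normalized v w :
  ((enorm v)%:C%C * hdot ((enorm v)^-1 *: v) w)%R = hdot v w.
Proof.
have [v0|v0] := eqVneq (enorm v) 0; last first.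
  by rewrite -hdotZ scalerA divff// scale1r.
rewrite v0 mul0r (enorm_eq0 v0) /hdot big1// => k _.
by rewrite mxE mul0r.
Qed.

Lemma normc_hdot_le v w : Normc.normc (hdot v w) <= enorm v * cnorm w.
Proof.
rewrite hdotE normcE/= /enorm /cnorm -sqrtrM ?sumr_ge0// => [|k _]; last first.
  exact: sqr_ge0.
rewrite ler_wsqrtr//.
apply: le_trans (lerD (sum_cauchy_schwarz _ _) (sum_cauchy_schwarz _ _)) _.
rewrite -mulrDr -big_split/=.
rewrite [X in _ <= _ * X](eq_bigr (fun k =>
  complex.Re (w ord0 k) ^+ 2 + complex.Im (w ord0 k) ^+ 2))// => k _.
by rewrite normcE sqr_sqrtr// addr_ge0 ?sqr_ge0.
Qed.

End hdot.

(** A function that vanishes outside Omega coincides with its extension by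
    zero, so that the norm is an integral over the whole space. *)
Lemma Lp_normE (R : realType) n N (Omega : set 'rV[R]_n) (g : 'rV[R]_n -> R) :
  (0 < N)%N -> (forall x, 0 <= g x) -> (forall x, ~ Omega x -> g x = 0) ->
  Lp_norm N%:R Omega g =
  ((\int[@lebesgue_rV R n]_x (g x ^+ N)%:E) `^ N%:R^-1)%E.
Proof.
move=> N0 g0 gO; rewrite /Lp_norm.
have -> : (EFin \o g) \_ Omega = EFin \o g.
  apply/funext => x; rewrite patchE; case: ifPn => // /negP xO /=.
  by rewrite gO// => Ox; apply: xO; rewrite inE.
rewrite unlock; congr (_ `^ _)%E; apply: eq_integral => x _ /=.
by rewrite ger0_norm// powR_mulrn.
Qed.

Theorem mainTheorem8 (R : realType) (N : nat) (s : seq nat)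
    (op : 'rV[R]_(N + sumn s) -> 'rV[R]_(N + sumn s) -> 'rV[R]_(N + sumn s))
    (X : 'I_N -> 'rV[R]_(N + sumn s) -> 'rV[R]_(N + sumn s))
    (hN : (2 <= N)%N) (hG : stratified_group op X)
    (Omega : set 'rV[R]_(N + sumn s))
    (Omega_open : open Omega) (Omega_connected : connected Omega)
    (Omega_bounded : bounded_set Omega) (Omega0 : Omega 0)
    (f : 'rV[R]_(N + sumn s) -> R[i])
    (hf : test_function (Omega `\` [set x | horizontal x = 0]) f) :
  (Lp_norm N%:R Omega (fun x => Normc.normc (f x)) <=
   Lp_norm N%:R Omega (fun x =>
     Normc.normc ((enorm (horizontal x))%:C%C *
       hdot ((enorm (horizontal x))^-1 *: horizontal x) (hgrad X f x))%R))%E /\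
  (Lp_norm N%:R Omega (fun x => Normc.normc (f x)) <=
   (sup [set enorm (horizontal x) | x in Omega])%:E *
   Lp_norm N%:R Omega (fun x => cnorm (hgrad X f x)))%E.
Proof.
have [su sv cK KO] := hf; set K := closure _ in cK KO.
set u := fun x => complex.Re (f x) in su.
set v := fun x => complex.Im (f x) in sv.
have [m NE] : exists m, N = m.+2.
  by exists (N - 2)%N; rewrite -[RHS]addn2 subnK.
have C1u := su 1%N; have C1v := sv 1%N.
have [du cdu] := C1u; have [dv cdv] := C1v.
have clK : closed K by exact: closed_closure.
have f0 x : ~ K x -> f x = 0.
  by move=> Kx; apply/eqP/negPn/negP => fx; apply: Kx; exact: subset_closure.
have u0 x : ~ K x -> u x = 0 by move=> Kx; rewrite /u f0.
have v0 x : ~ K x -> v x = 0 by move=> Kx; rewrite /v f0.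
have OK x : ~ Omega x -> ~ K x by move=> Ox /KO[].
have du0 x e : ~ K x -> 'd u x e = 0.
  by move=> Kx; exact: (diff_support _ clK u0).
have dv0 x e : ~ K x -> 'd v x e = 0.
  by move=> Kx; exact: (diff_support _ clK v0).
have vfE k x : vf_apply (X k) f x = ('d u x (X k x) +i* 'd v x (X k x))%C.
  by rewrite /vf_apply !deriveE.
pose Z := radial_field X.
have hdE x : hdot (horizontal x) (hgrad X f x) =
    ('d u x (Z x) +i* 'd v x (Z x))%C.
  rewrite hdotE /Z /radial_field !linear_sum/=.
  by congr (_ +i* _)%C; apply: eq_bigr => k _; rewrite !mxE vfE linearZ.
pose q x := Normc.normc (hdot (horizontal x) (hgrad X f x)).
have -> : (fun x => Normc.normc ((enorm (horizontal x))%:C%C *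
      hdot ((enorm (horizontal x))^-1 *: horizontal x) (hgrad X f x))%R) = q.
  by apply/funext => x; rewrite hdot_normalized.
pose c x := cnorm (hgrad X f x).
have N0 : (0 < N)%N by exact: ltnW.
have normc0 (z : R[i]) : 0 <= Normc.normc z by rewrite normcE sqrtr_ge0.
have qge0 x : 0 <= q x by exact: normc0.
have q0 x : ~ Omega x -> q x = 0.
  by move=> /OK Kx; rewrite /q hdE normcE/= du0// dv0// !expr0n addr0 sqrtr0.
have c0 x : ~ K x -> c x = 0.
  move=> Kx; rewrite /c /cnorm big1 ?sqrtr0// => k _.
  by rewrite mxE vfE normcE/= du0// dv0// !expr0n addr0 sqrtr0 expr0n.
have fO x : ~ Omega x -> Normc.normc (f x) = 0.
  by move=> /OK /f0 ->; rewrite normcE/= !expr0n addr0 sqrtr0.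
have qE x : q x = Num.sqrt ('d u x (Z x) ^+ 2 + 'd v x (Z x) ^+ 2).
  by rewrite /q hdE normcE.
have main : (Lp_norm N%:R Omega (fun x => Normc.normc (f x)) <=
    Lp_norm N%:R Omega q)%E.
  rewrite !Lp_normE//.
  apply: gt0_ler_poweR.
  - by rewrite invr_ge0.
  - rewrite in_itv/= leey andbT integral_ge0// => x _.
    by rewrite lee_fin exprn_ge0.
  - rewrite in_itv/= leey andbT integral_ge0// => x _.
    by rewrite lee_fin exprn_ge0.
  have := radial_hardy hG NE C1u C1v cK u0 v0.
  rewrite -NE.
  under eq_integral do rewrite -normcE.
  by under [leRHS]eq_integral do rewrite -qE.
split=> //; apply: le_trans main _.
set S := sup _.
have [B OB] : exists B, forall x, Omega x -> enorm (horizontal x) <= B.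
  have [M [_ MO]] := Omega_bounded.
  exists (Num.sqrt (\sum_(k < N) (`|M| + 1) ^+ 2)) => x Ox.
  rewrite ler_wsqrtr// ler_sum// => k _; rewrite mxE -real_normK ?num_real//.
  rewrite lerXn2r ?nnegrE ?addr_ge0//.
  apply: (le_trans _ (MO (`|M| + 1) _ x Ox)); last first.
    by rewrite (le_lt_trans (ler_norm M))// ltrDl.
  rewrite [leRHS]/Num.norm/= mx_normrE.
  by apply/bigmax_geP; right; exists (ord0, lshift (sumn s) k).
have SO x : Omega x -> enorm (horizontal x) <= S.
  move=> Ox; apply: sup_ubound; last by exists x.
  by exists B => _ [y Oy <-]; exact: OB.
have S0 : 0 <= S by apply: le_trans (SO 0 Omega0); exact: sqrtr_ge0.
have cge0 x : 0 <= c x by exact: sqrtr_ge0.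
have qc x : q x <= S * c x.
  have [Ox|Ox] := pselect (Omega x); last by rewrite q0// mulr_ge0.
  apply: le_trans (normc_hdot_le _ _) _.
  by apply: ler_wpM2r; [exact: cge0|exact: SO].
have cc : continuous c.
  have -> : c = fun x => Num.sqrt
      (\sum_k ('d u x (X k x) ^+ 2 + 'd v x (X k x) ^+ 2)).
    apply/funext => x; congr Num.sqrt; apply: eq_bigr => k _.
    by rewrite mxE vfE normcE sqr_sqrtr// addr_ge0// sqr_ge0.
  move=> x; apply: (@continuous_comp _ _ _ _ Num.sqrt);
    last exact: sqrt_continuous.
  apply: continuous_big => [|k _ y]; first exact: add_continuous.
  have cX := field_continuous hG.
  apply: (@continuousD _ _ _ (fun x => 'd u x (X k x) ^+ 2)
    (fun x => 'd v x (X k x) ^+ 2)).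
    apply: (@continuous_comp _ _ _ (fun x => 'd u x (X k x)) (fun r => r ^+ 2)).
      by apply: continuous_diff_field => // j; exact: cX.
    exact: exprn_continuous.
  apply: (@continuous_comp _ _ _ (fun x => 'd v x (X k x)) (fun r => r ^+ 2)).
    by apply: continuous_diff_field => // j; exact: cX.
  exact: exprn_continuous.
have ccN : continuous (fun x => c x ^+ N).
  move=> x; apply: (@continuous_comp _ _ _ c (fun r => r ^+ N)).
    exact: cc.
  exact: exprn_continuous.
have mc : measurable_fun [set: 'rV[measurableTypeR R]_(N + sumn s)]
    (fun x => (c x ^+ N)%:E).
  by apply/measurable_EFinP; exact: (continuous_measurable_rV ccN).
have cO x : ~ Omega x -> c x = 0 by move=> /OK /c0.
rewrite !Lp_normE//.
(* Put S inside the power 1/N so as to compare integrals. *)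
have SE : S%:E = (((S ^+ N)%:E) `^ N%:R^-1)%E.
  by rewrite poweR_EFin -powR_mulrn// -powRrM divff ?powRr1// pnatr_eq0 gt_eqF.
have intc0 : (0 <= \int[@lebesgue_rV R (N + sumn s)]_x (c x ^+ N)%:E)%E.
  by apply: integral_ge0 => x _; rewrite lee_fin exprn_ge0.
rewrite SE -poweRM//; last by rewrite lee_fin exprn_ge0.
rewrite -ge0_integralZl_EFin//; first last.
- by rewrite exprn_ge0.
- by move=> x _; rewrite lee_fin; apply: exprn_ge0; exact: cge0.
apply: gt0_ler_poweR.
- by rewrite invr_ge0.
- rewrite in_itv/= leey andbT integral_ge0// => x _.
  by rewrite lee_fin exprn_ge0.
- rewrite in_itv/= leey andbT integral_ge0// => x _.
  rewrite -EFinM lee_fin; apply: mulr_ge0; apply: exprn_ge0; first exact: S0.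
  exact: cge0.
apply: ge0_le_integral => //.
- by move=> x _; rewrite lee_fin; apply: exprn_ge0; exact: qge0.
- have -> : (fun x => (q x ^+ N)%:E) = EFin \o (fun x =>
      Num.sqrt ('d u x (Z x) ^+ 2 + 'd v x (Z x) ^+ 2) ^+ N).
    by apply/funext => x /=; rewrite qE.
  apply/measurable_EFinP; apply: continuous_measurable_rV.
  have cZ := continuous_radial_field hG.
  apply: (@continuous_modulus _ _ (fun x => 'd u x (Z x))
    (fun x => 'd v x (Z x))).
    exact: (@continuous_diff_field R _ u Z cdu cZ).
  exact: (@continuous_diff_field R _ v Z cdv cZ).
- exact: measurable_funeM.
- move=> x _; rewrite -EFinM lee_fin -exprMn.
  apply: lerXn2r; rewrite ?nnegrE; [exact: qge0| |exact: qc].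
  by apply: mulr_ge0; [exact: S0|exact: cge0].
Qed.
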